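(* The category $\mathsf{Frm}$ of frames and frame homomorphisms is equivalent to the category $\mathsf{CDTop}$ of completely distributive topological T$_0$-spaces and those continuous maps which have both a left adjoint and a right adjoint in $\mathsf{Top}$.
   Context: For a topological space $X$ the underlying order is $x\le y$ iff $y\in\mathrm{cl}\{x\}$ (the dual of the specialisation order). Continuous maps $f,g\colon X\to Y$ are ordered pointwise with respect to the underlying order of $Y$; $f\dashv g$ ($f\colon X\to Y$, $g\colon Y\to X$ continuous) means $1_X\le g\cdot f$ and $f\cdot g\le 1_Y$. For a frame $L$, $FL$ is the set of all filters $\mathfrak f\subseteq L$ (up-closed, containing the top, closed under binary meets, possibly $\mathfrak f=L$), with the topology having the sets $x^\#=\{\mathfrak f\in FL\mid x\in\mathfrak f\}$, $x\in L$, as basic opens. $\mathcal OX$ is the frame of opens of $X$. $PX$ denotes the filter space $F(\mathcal OX)$ (canonically homeomorphic to the presheaf space $\mathsf 2^{X^{\mathrm{op}}}$), and the Yoneda embedding $y_X\colon X\to PX$ sends $x$ to its filter of open neighbourhoods. $X$ is cocomplete if $y_X$ has a left adjoint $\mathrm{Sup}_X\colon PX\to X$ in $\mathsf{Top}$; a cocomplete $X$ is completely distributive if $\mathrm{Sup}_X$ has a left adjoint $t_X\colon X\to PX$ in $\mathsf{Top}$. *)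

(* Defs.v *)
From HB Require Import structures.
From mathcomp Require Import all_boot all_order.
From mathcomp Require Import boolp classical_sets filter topology.

Set Implicit Arguments.
Unset Strict Implicit.
Unset Printing Implicit Defensive.

Import Order.TTheory.
Local Open Scope classical_set_scope.
Local Open Scope order_scope.

(** * Categories *)

Record category := Category {
  obj :> Type;
  hom : obj -> obj -> Type;
  idm : forall A, hom A A;
  comp : forall A B C, hom B C -> hom A B -> hom A C;
  comp_idl : forall A B (f : hom A B), comp (idm B) f = f;
  comp_idr : forall A B (f : hom A B), comp f (idm A) = f;
  compA : forall A B C D (h : hom C D) (g : hom B C) (f : hom A B),
    comp h (comp g f) = comp (comp h g) f
}.

Record functor (C D : category) := Functor {
  fobj :> C -> D;
  fmap : forall A B : C, hom A B -> hom (fobj A) (fobj B);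
  fmap_id : forall A : C, fmap (idm A) = idm (fobj A);
  fmap_comp : forall (A B E : C) (g : hom B E) (f : hom A B),
    fmap (comp g f) = comp (fmap g) (fmap f)
}.

Definition functor_id (C : category) : functor C C :=
  @Functor C C id (fun A B f => f) (fun A => erefl) (fun A B E g f => erefl).

Section FunctorComp.
Variables (C D E : category) (G : functor D E) (F : functor C D).

Let fmap_GF (A B : C) (f : hom A B) : hom (G (F A)) (G (F B)) :=
  fmap G (fmap F f).

Lemma functor_comp_id (A : C) : fmap_GF (idm A) = idm (G (F A)).
Proof. by rewrite /fmap_GF fmap_id fmap_id. Qed.

Lemma functor_comp_comp (A B B' : C) (g : hom B B') (f : hom A B) :
  fmap_GF (comp g f) = comp (fmap_GF g) (fmap_GF f).
Proof. by rewrite /fmap_GF fmap_comp fmap_comp. Qed.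

Definition functor_comp : functor C E :=
  Functor functor_comp_id functor_comp_comp.

End FunctorComp.

Definition is_iso (C : category) (A B : C) (f : hom A B) : Prop :=
  exists g : hom B A, comp g f = idm A /\ comp f g = idm B.

Definition naturally_isomorphic (C D : category) (F G : functor C D) : Prop :=
  exists eta : forall A : C, hom (F A) (G A),
    (forall (A B : C) (f : hom A B),
      comp (fmap G f) (eta A) = comp (eta B) (fmap F f)) /\
    (forall A : C, is_iso (eta A)).

Definition equivalent_categories (C D : category) : Prop :=
  exists (F : functor C D) (G : functor D C),
    naturally_isomorphic (functor_id C) (functor_comp G F) /\
    naturally_isomorphic (functor_comp F G) (functor_id D).

Section ConcreteCategory.
Variables (T : Type) (U : T -> Type) (P : forall A B : T, (U A -> U B) -> Prop).
Hypothesis P_id : forall A : T, P (@id (U A)).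
Hypothesis P_comp : forall (A B C : T) (g : U B -> U C) (f : U A -> U B),
  P g -> P f -> P (g \o f).

Let hom' (A B : T) : Type := {f : U A -> U B | P f}.
Let idm' (A : T) : hom' A A := exist _ id (P_id A).
Let comp' (A B C : T) (g : hom' B C) (f : hom' A B) : hom' A C :=
  exist _ (sval g \o sval f) (P_comp (svalP g) (svalP f)).

Lemma concrete_hom_ext (A B : T) (f g : hom' A B) : sval f = sval g -> f = g.
Proof. by case: f g => [f Pf] [g Pg] /= e; apply: eq_exist. Qed.

Lemma concrete_idl (A B : T) (f : hom' A B) : comp' (idm' B) f = f.
Proof. exact: concrete_hom_ext. Qed.

Lemma concrete_idr (A B : T) (f : hom' A B) : comp' f (idm' A) = f.
Proof. exact: concrete_hom_ext. Qed.

Lemma concrete_compA (A B C D : T)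
    (h : hom' C D) (g : hom' B C) (f : hom' A B) :
  comp' h (comp' g f) = comp' (comp' h g) f.
Proof. exact: concrete_hom_ext. Qed.

Definition concrete_category : category :=
  Category concrete_idl concrete_idr concrete_compA.

End ConcreteCategory.

(** * Frames *)

HB.mixin Record isFrame d T of Order.TBLattice d T := {
  frame_has_sup : forall A : set T, supremums A !=set0;
  frame_meet_sup : forall (x : T) (A : set T) (s : T),
    supremums A s -> supremums [set x `&` a | a in A] (x `&` s)
}.

#[short(type="frameType")]
HB.structure Definition Frame d := { T of Order.TBLattice d T & isFrame d T }.

Definition frame_hom d (L : frameType d) d' (M : frameType d') (f : L -> M) :
    Prop :=
  [/\ f \top = \top,
      forall x y, f (x `&` y) = f x `&` f y &
      forall (A : set L) (s : L), supremums A s -> supremums (f @` A) (f s)].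

(* A display is a printing tag (all displays are equal), so letting it vary
   adds nothing mathematically to the objects. *)
Record frame := MkFrame {
  frame_disp : Order.disp_t;
  frame_sort :> frameType frame_disp
}.

Lemma frame_hom_id d (L : frameType d) : frame_hom (@id L).
Proof. by split=> // A s; rewrite image_id. Qed.

Lemma frame_hom_comp d (L : frameType d) d' (M : frameType d')
    d'' (N : frameType d'') (g : M -> N) (f : L -> M) :
  frame_hom g -> frame_hom f -> frame_hom (g \o f).
Proof.
move=> [g1 gI gS] [f1 fI fS]; split=> /=; first by rewrite f1.
  by move=> x y; rewrite fI gI.
by move=> A s /fS/gS; rewrite image_comp.
Qed.

Definition Frm : category :=
  @concrete_category frame (fun L => L) (fun L M f => frame_hom f)
    (fun L => frame_hom_id L) (fun L M N g f => @frame_hom_comp _ L _ M _ N g f).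

(** * The frame of opens of a topological space *)

Record opens (X : topologicalType) := Opens {
  open_set :> set X;
  open_setP : open open_set
}.

Lemma opens_ext (X : topologicalType) (U V : opens X) :
  open_set U = open_set V -> U = V.
Proof.
by case: U V => [U oU] [V oV] /= e; subst V; congr Opens; exact: Prop_irrelevance.
Qed.

HB.instance Definition _ (X : topologicalType) := gen_eqMixin (opens X).
HB.instance Definition _ (X : topologicalType) := gen_choiceMixin (opens X).

Fact opens_display : Order.disp_t. Proof. exact: Order.Disp tt tt. Qed.

Section OpensFrame.
Variable X : topologicalType.
Implicit Types U V W : opens X.

Definition opens_le U V : bool := `[< open_set U `<=` open_set V >].

Lemma opens_le_refl : reflexive opens_le.
Proof. by move=> U; apply/asboolP. Qed.

Lemma opens_le_anti : antisymmetric opens_le.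
Proof.
by move=> U V /andP[/asboolP UV /asboolP VU]; apply: opens_ext; apply/seteqP.
Qed.

Lemma opens_le_trans : transitive opens_le.
Proof.
by move=> V U W /asboolP UV /asboolP VW; apply/asboolP; exact: subset_trans VW.
Qed.

HB.instance Definition _ := Order.Le_isPOrder.Build opens_display (opens X)
  opens_le_refl opens_le_anti opens_le_trans.

Lemma opens_leP U V : reflect (open_set U `<=` open_set V) (U <= V).
Proof. exact: asboolP. Qed.

Definition opens_meet U V : opens X := Opens (openI (open_setP U) (open_setP V)).
Definition opens_join U V : opens X := Opens (openU (open_setP U) (open_setP V)).
Definition opens_bot : opens X := Opens open0.
Definition opens_top : opens X := Opens openT.

Lemma opens_meetP U V W : (U <= opens_meet V W) = (U <= V) && (U <= W).
Proof.
apply/idP/andP => [/opens_leP/= |[/opens_leP UV /opens_leP UW]].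
  by rewrite subsetI => -[UV UW]; split; apply/opens_leP.
by apply/opens_leP; rewrite subsetI.
Qed.

Lemma opens_joinP U V W : (opens_join U V <= W) = (U <= W) && (V <= W).
Proof.
apply/idP/andP => [/opens_leP/= |[/opens_leP UW /opens_leP VW]].
  by rewrite subUset => -[UW VW]; split; apply/opens_leP.
by apply/opens_leP; rewrite subUset.
Qed.

HB.instance Definition _ := Order.POrder_MeetJoin_isLattice.Build
  opens_display (opens X) opens_meetP opens_joinP.

Lemma opens_le0x U : opens_bot <= U.
Proof. by apply/opens_leP; exact: sub0set. Qed.

Lemma opens_lex1 U : U <= opens_top.
Proof. by apply/opens_leP; exact: subsetT. Qed.

HB.instance Definition _ :=
  Order.hasBottom.Build opens_display (opens X) opens_le0x.
HB.instance Definition _ :=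
  Order.hasTop.Build opens_display (opens X) opens_lex1.

Definition opens_sup (A : set (opens X)) : opens X :=
  Opens (bigcup_open (fun U (_ : A U) => open_setP U)).

Lemma opens_supP (A : set (opens X)) : supremums A (opens_sup A).
Proof.
split=> [U AU|V AV]; apply/opens_leP => /= x.
  by move=> Ux; exists U.
by move=> [U AU Ux]; exact: (opens_leP U V (AV U AU)).
Qed.

Lemma opens_has_sup (A : set (opens X)) : supremums A !=set0.
Proof. by exists (opens_sup A); exact: opens_supP. Qed.

Lemma opens_meet_sup U (A : set (opens X)) (S : opens X) :
  supremums A S -> supremums [set U `&` V | V in A] (U `&` S).
Proof.
move=> [ubS lubS]; split=> [_ [V AV <-]|W ubW]; first exact: leI2 (ubS _ AV).
apply/opens_leP => x [Ux Sx].
have /opens_leP/(_ x Sx)[V AV Vx] : S <= opens_sup A.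
  by apply: lubS; case: (opens_supP A).
by apply: (opens_leP (U `&` V) W _ x) => //; apply: ubW; exists V.
Qed.

HB.instance Definition _ := isFrame.Build opens_display (opens X)
  opens_has_sup opens_meet_sup.

End OpensFrame.

(** * Filter spaces *)

Record filters d (L : frameType d) := Filters {
  filter_set :> set L;
  filter_top : filter_set \top;
  filter_up : forall x y, x <= y -> filter_set x -> filter_set y;
  filter_meet : forall x y, filter_set x -> filter_set y -> filter_set (x `&` y)
}.

HB.instance Definition _ d (L : frameType d) := gen_eqMixin (filters L).
HB.instance Definition _ d (L : frameType d) := gen_choiceMixin (filters L).

Section FilterSpace.
Context {d : Order.disp_t} {L : frameType d}.

Definition sharp (x : L) : set (filters L) := [set F | filter_set F x].

Definition filters_open : set_system (filters L) :=
  [set U | exists S : set L, U = \bigcup_(x in S) sharp x].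

Lemma filters_openT : filters_open setT.
Proof.
exists [set \top]; rewrite bigcup_set1; apply/esym/seteqP; split=> // F _.
exact: filter_top.
Qed.

Lemma filters_openI : setI_closed filters_open.
Proof.
move=> _ _ [S ->] [T ->].
exists [set z | exists x y, [/\ S x, T y & z = x `&` y]].
apply/seteqP; split=> F.
  move=> [[x Sx Fx] [y Ty Fy]]; exists (x `&` y); last exact: filter_meet.
  by exists x, y.
move=> [_ [x [y [Sx Ty ->]]] Fxy].
by split; [exists x => //|exists y => //]; apply: filter_up Fxy;
  rewrite ?leIl ?leIr.
Qed.

Lemma filters_open_bigU (I : Type) (f : I -> set (filters L)) :
  (forall i, filters_open (f i)) -> filters_open (\bigcup_i f i).
Proof.
move=> /choice[S fS]; exists (\bigcup_i S i).
apply/seteqP; split=> F [].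
  by move=> i _; rewrite fS => -[x Sx Fx]; exists x => //; exists i.
by move=> x [i _ Sx] Fx; exists i => //; rewrite fS; exists x.
Qed.

HB.instance Definition _ := isOpenTopological.Build (filters L)
  filters_openT filters_openI filters_open_bigU.

End FilterSpace.

(** * Completely distributive spaces *)

(* the dual of the specialisation order *)
Definition under_le (X : topologicalType) (x y : X) : Prop :=
  closure [set x] y.

(* f -| g in Top, with f the left adjoint *)
Definition adjoint (X Y : topologicalType) (f : X -> Y) (g : Y -> X) : Prop :=
  [/\ continuous f, continuous g,
      forall x : X, under_le x (g (f x)) &
      forall y : Y, under_le (f (g y)) y].

Definition presheaf_space (X : topologicalType) : topologicalType :=
  filters (opens X).

Section Yoneda.
Variables (X : topologicalType) (x : X).

Let nbhd : set (opens X) := [set U | open_set U x].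

Lemma nbhd_up (U V : opens X) : U <= V -> nbhd U -> nbhd V.
Proof. by move=> /opens_leP UV; exact: UV. Qed.

Definition yoneda : presheaf_space X :=
  @Filters _ (opens X) nbhd I nbhd_up (fun U V Ux Vx => conj Ux Vx).

End Yoneda.

(* The choice of Sup is immaterial: two left adjoints of the same map are
   equivalent in the pointwise underlying order, hence have the same left
   adjoints. *)
Definition completely_distributive (X : topologicalType) : Prop :=
  exists Sup : presheaf_space X -> X, adjoint Sup (@yoneda X) /\
  exists t : X -> presheaf_space X, adjoint t Sup.

(** * The category CDTop *)

Record cdspace := CDSpace {
  cd_sort :> topologicalType;
  cd_T0 : kolmogorov_space cd_sort;
  cd_distributive : completely_distributive cd_sort
}.

Definition cd_hom (X Y : topologicalType) (f : X -> Y) : Prop :=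
  [/\ continuous f,
      exists l : Y -> X, adjoint l f &
      exists r : Y -> X, adjoint f r].

Lemma under_le_refl (X : topologicalType) (x : X) : under_le x x.
Proof. exact: subset_closure. Qed.

Lemma under_le_trans (X : topologicalType) (y x z : X) :
  under_le x y -> under_le y z -> under_le x z.
Proof.
move=> xy yz B; rewrite nbhsE => -[C [oC Cz] CB].
have [_ [-> Cy]] := yz C (open_nbhs_nbhs (conj oC Cz)).
have [_ [-> Cx]] := xy C (open_nbhs_nbhs (conj oC Cy)).
by exists x; split=> //; exact: CB.
Qed.

Lemma under_le_mono (X Y : topologicalType) (f : X -> Y) (x y : X) :
  continuous f -> under_le x y -> under_le (f x) (f y).
Proof.
move=> cf xy B /cf/xy[_ [-> Bfx]].
by exists (f x).
Qed.

Lemma adjoint_id (X : topologicalType) : adjoint (@id X) (@id X).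
Proof.
by split=> [||x|x]; [move=> ?; exact: cvg_id|move=> ?; exact: cvg_id| |];
  exact: under_le_refl.
Qed.

Lemma adjoint_comp (X Y Z : topologicalType) (f : X -> Y) (g : Y -> X)
    (f' : Y -> Z) (g' : Z -> Y) :
  adjoint f g -> adjoint f' g' -> adjoint (f' \o f) (g \o g').
Proof.
move=> [cf cg u v] [cf' cg' u' v']; split=> [x|z|x|z] /=.
- by apply: continuous_comp; [exact: cf|exact: cf'].
- by apply: continuous_comp; [exact: cg'|exact: cg].
- exact: under_le_trans (u x) (under_le_mono cg (u' (f x))).
- exact: under_le_trans (under_le_mono cf' (v (g' z))) (v' z).
Qed.

Lemma cd_hom_id (X : topologicalType) : cd_hom (@id X).
Proof.
by split; [move=> ?; exact: cvg_id| |]; exists id; exact: adjoint_id.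
Qed.

Lemma cd_hom_comp (X Y Z : topologicalType) (g : Y -> Z) (f : X -> Y) :
  cd_hom g -> cd_hom f -> cd_hom (g \o f).
Proof.
move=> [cg [lg ag] [rg bg]] [cf [lf af] [rf bf]]; split.
- by move=> x; apply: continuous_comp; [exact: cf|exact: cg].
- by exists (lf \o lg); exact: adjoint_comp.
- by exists (rf \o rg); exact: adjoint_comp.
Qed.

Definition CDTop : category :=
  @concrete_category cdspace (fun X => X) (fun X Y f => cd_hom f)
    (fun X => @cd_hom_id X) (fun X Y Z g f => @cd_hom_comp X Y Z g f).

(* Main.v *)
(** The frame [L] is sent to its filter space, a frame homomorphism [f] to the
direct image of filters; since [f] has a right adjoint [g] that preserves
finite meets, the adjunctions [f^-1 -| f_! -| g_!] put [f_!] in [CDTop].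
In the filter space [Sup] is the preimage under [x |-> x#], and its left adjoint
[t] is the preimage under the left adjoint of [x |-> x#].

Conversely, [L] is recovered from its filter space as the set of points whose
down-set is open.  In a completely distributive T0-space [X], every open [U] has
such a point as its supremum, because [z <= sup U] iff [U] belongs to [t z];
this also gives the frame structure on these points.  Applying continuity of
[Sup] at [t x] shows that the open principal down-sets form a basis of [X], so
[X] is homeomorphic to the space of filters of this frame.  *)

From HB Require Import structures.
From mathcomp Require Import all_boot all_order.
From mathcomp Require Import boolp classical_sets filter topology.
Require Import Defs.

Set Implicit Arguments.
Unset Strict Implicit.
Unset Printing Implicit Defensive.

Import Order.TTheory.
Local Open Scope classical_set_scope.
Local Open Scope order_scope.

(** * The underlying order *)

Definition down (X : topologicalType) (x : X) : set X := [set z | under_le z x].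

Section UnderlyingOrder.
Variable X : topologicalType.
Implicit Types x y z : X.

(** Open sets are thus down-sets, and [down y] is the intersection of the open neighbourhoods of
    [y]. *)
Lemma under_leP x y :
  under_le x y <-> forall U : set X, open U -> U y -> U x.
Proof.
split=> [xy U oU Uy|xy B].
  by have [_ [-> Ux]] := xy U (open_nbhs_nbhs (conj oU Uy)).
rewrite nbhsE => -[C [oC Cy] CB].
by exists x; split=> //; apply: CB; exact: xy oC Cy.
Qed.

Lemma under_le_anti x y :
  kolmogorov_space X -> under_le x y -> under_le y x -> x = y.
Proof.
move=> T0 /under_leP xy /under_leP yx; apply: contrapT => /eqP/T0[A].
rewrite !inE => -[[+ nAy]|[+ nAx]]; rewrite nbhsE => -[C [oC Cp] CA].
  by apply: nAy; apply: CA; exact: yx oC Cp.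
by apply: nAx; apply: CA; exact: xy oC Cp.
Qed.

Lemma down_sub_open (U : set X) x : open U -> U x -> down x `<=` U.
Proof. by move=> oU Ux z /under_leP; apply. Qed.

End UnderlyingOrder.

Lemma adjoint_le (X Y : topologicalType) (f : X -> Y) (g : Y -> X) x y :
  adjoint f g -> under_le (f x) y <-> under_le x (g y).
Proof.
move=> [cf cg u v]; split=> [fxy|xgy].
  exact: under_le_trans (u x) (under_le_mono cg fxy).
exact: under_le_trans (under_le_mono cf xgy) (v y).
Qed.

(** A homeomorphism is both left and right adjoint to its inverse; this puts the unit and counit
    homeomorphisms in [CDTop]. *)
Lemma adjoint_can (X Y : topologicalType) (f : X -> Y) (g : Y -> X) :
  continuous f -> continuous g -> cancel f g -> cancel g f -> adjoint f g.
Proof.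
by move=> cf cg fK gK; split=> // z; rewrite ?fK ?gK; exact: under_le_refl.
Qed.

(** * Maps between filter spaces *)

Section Filters.
Context d (L : frameType d).
Implicit Types (x y : L) (F G : filters L).

Lemma filters_ext F G : (forall x, filter_set F x <-> filter_set G x) -> F = G.
Proof.
case: F G => [F F1 F2 F3] [G G1 G2 G3] /= FG.
have e : F = G by apply/seteqP; split=> x /FG.
by subst G; congr Filters; exact: Prop_irrelevance.
Qed.

Lemma filters_openP (U : set (filters L)) :
  open U <-> forall F, U F -> exists2 x, filter_set F x & sharp x `<=` U.
Proof.
split=> [|UP].
  case=> S -> F [x Sx Fx]; exists x => // G Gx; by exists x.
exists [set x | sharp x `<=` U]; apply/seteqP; split=> F.
  by move=> /UP[x Fx xU]; exists x.
by move=> [x xU]; exact: xU.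
Qed.

Lemma open_sharp x : open (sharp x).
Proof. by apply/filters_openP => F Fx; exists x. Qed.

Lemma filters_leP F G :
  under_le F G <-> forall x, filter_set G x -> filter_set F x.
Proof.
split=> [/under_leP FG x Gx|GF]; first exact: FG (open_sharp x) Gx.
by apply/under_leP => U /filters_openP + UG => /(_ _ UG)[x /GF Fx]; apply.
Qed.

Lemma filters_T0 : kolmogorov_space (filters L).
Proof.
move=> F G /eqP FG; apply: contrapT => nsep; apply: FG; apply: filters_ext => x.
split=> Hx; apply: contrapT => nHx; apply: nsep; exists (sharp x);
  [left|right]; rewrite !inE; split=> //;
  exact: open_nbhs_nbhs (conj (open_sharp x) Hx).
Qed.

Lemma principal_filter_meet x y z : x <= y -> x <= z -> x <= y `&` z.
Proof. by rewrite lexI => -> ->. Qed.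

Definition principal_filter x : filters L :=
  @Filters _ L [set y | x <= y] (lex1 x)
    (fun y z yz xy => le_trans xy yz) (principal_filter_meet (x := x)).

(** The order is reverse inclusion, so [principal_filter x] is the greatest point of [sharp x]. *)
Lemma sharp_subP x (U : set (filters L)) :
  open U -> sharp x `<=` U <-> U (principal_filter x).
Proof.
move=> /filters_openP oU; split=> [xU|/oU[y xy yU] F Fx].
  by apply: xU; exact: lexx.
by apply: yU; exact: filter_up xy Fx.
Qed.

Lemma sharp_downE x : sharp x = down (principal_filter x).
Proof.
apply/seteqP; split=> F; last by move=> /filters_leP; apply=> /=.
by move=> Fx; apply/filters_leP => y xy; exact: filter_up xy Fx.
Qed.

End Filters.

Lemma filters_continuous (X : topologicalType) d (L : frameType d)
    (f : X -> filters L) :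
  (forall x, open (f @^-1` sharp x)) -> continuous f.
Proof.
move=> fo; apply/continuousP => A [S ->].
by rewrite preimage_bigcup; apply: bigcup_open => x _.
Qed.

Definition meet_hom d (L : frameType d) d' (M : frameType d') (g : L -> M) :=
  g \top = \top /\ forall x y, g (x `&` y) = g x `&` g y.

Definition galois d (L : frameType d) d' (M : frameType d')
    (f : L -> M) (g : M -> L) := forall x y, (f x <= y) = (x <= g y).

(** * Direct and inverse images of filters *)

Section FilterMaps.
Context d (L : frameType d) d' (M : frameType d') (g : L -> M).
Hypothesis gP : meet_hom g.

Lemma meet_hom_le x y : x <= y -> g x <= g y.
Proof. by move=> /meet_idPl xy; rewrite -xy gP.2 leIr. Qed.

Let im (F : filters L) : set M :=
  [set m | exists2 x, filter_set F x & g x <= m].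

Lemma filter_image_top F : im F \top.
Proof. by exists \top; rewrite ?lex1 //; exact: filter_top. Qed.

Lemma filter_image_up F x y : x <= y -> im F x -> im F y.
Proof. by move=> xy [z Fz zx]; exists z => //; exact: le_trans xy. Qed.

Lemma filter_image_meet F x y : im F x -> im F y -> im F (x `&` y).
Proof.
move=> [a Fa ax] [b Fb ly]; exists (a `&` b); first exact: filter_meet.
by rewrite gP.2 leI2.
Qed.

Definition filter_image (F : filters L) : filters M :=
  Filters (filter_image_top F) (@filter_image_up F) (@filter_image_meet F).

Let preim (F : filters M) : set L := [set x | filter_set F (g x)].

Lemma filter_preimage_top F : preim F \top.
Proof. by rewrite /preim /= gP.1; exact: filter_top. Qed.

Lemma filter_preimage_up F x y : x <= y -> preim F x -> preim F y.
Proof. by move=> /meet_hom_le; exact: filter_up. Qed.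

Lemma filter_preimage_meet F x y : preim F x -> preim F y -> preim F (x `&` y).
Proof. by rewrite /preim /= gP.2; exact: filter_meet. Qed.

Definition filter_preimage (F : filters M) : filters L :=
  Filters (filter_preimage_top F) (@filter_preimage_up F)
    (@filter_preimage_meet F).

Lemma filter_image_continuous : continuous filter_image.
Proof.
apply: filters_continuous => m; apply/filters_openP => F [x Fx xm].
by exists x => // G Gx; exists x.
Qed.

Lemma filter_preimage_continuous : continuous filter_preimage.
Proof. by apply: filters_continuous => x; exact: open_sharp (g x). Qed.

Lemma adjoint_preimage_image : adjoint filter_preimage filter_image.
Proof.
split=> [||F|F]; [exact: filter_preimage_continuous
  |exact: filter_image_continuous| |]; apply/filters_leP => x.
  by move=> [y Fy yx]; exact: filter_up yx Fy.
by move=> Fx; exists x.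
Qed.

Lemma filter_image_principal x :
  filter_image (principal_filter x) = principal_filter (g x).
Proof.
apply: filters_ext => y; split=> [[z /= /meet_hom_le xz]|xy].
  exact: le_trans.
by exists x => //; exact: lexx.
Qed.

End FilterMaps.

Section GaloisFilterMaps.
Context d (L : frameType d) d' (M : frameType d') (f : L -> M) (g : M -> L).
Hypotheses (fP : meet_hom f) (gP : meet_hom g) (fg : galois f g).

Lemma adjoint_image : adjoint (filter_image fP) (filter_image gP).
Proof.
split=> [||F|F]; [exact: filter_image_continuous
  |exact: filter_image_continuous| |]; apply/filters_leP => x.
  move=> [y [z Fz zy] yx]; apply: filter_up Fz.
  by apply: le_trans yx; rewrite -fg.
by move=> Fx; exists (g x); [exists x|rewrite fg].
Qed.

(** Inverse image reverses both composition and the pointwise order, so [f] stays on the left. *)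
Lemma adjoint_preimage : adjoint (filter_preimage fP) (filter_preimage gP).
Proof.
split=> [||F|F]; [exact: filter_preimage_continuous
  |exact: filter_preimage_continuous| |]; apply/filters_leP => x /=.
  by apply: filter_up; rewrite fg.
by apply: filter_up; rewrite -fg.
Qed.

End GaloisFilterMaps.

(** * From frames to completely distributive spaces *)

Section FrameSup.
Context d (L : frameType d).
Implicit Types (A B : set L) (x : L).

Definition frame_sup A : L := sval (cid (frame_has_sup A)).

Lemma frame_supP A : supremums A (frame_sup A).
Proof. exact: svalP (cid (frame_has_sup A)). Qed.

Lemma le_frame_sup A x : A x -> x <= frame_sup A.
Proof. by move=> Ax; have [+ _] := frame_supP A; exact. Qed.

Lemma frame_sup_le A x : (forall a, A a -> a <= x) -> frame_sup A <= x.
Proof. by move=> Ax; have [_] := frame_supP A; apply. Qed.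

(** Frame distributivity is applied once in each argument. *)
Lemma frame_supI_le A B x :
  (forall a b, A a -> B b -> a `&` b <= x) ->
  frame_sup A `&` frame_sup B <= x.
Proof.
move=> ABx; have [_] := frame_meet_sup (frame_sup A) _ _ (frame_supP B).
apply=> _ [b Bb <-]; rewrite meetC.
have [_] := frame_meet_sup b _ _ (frame_supP A).
by apply=> _ [a Aa <-]; rewrite meetC; exact: ABx.
Qed.

End FrameSup.

Lemma frame_hom_meet d (L : frameType d) d' (M : frameType d') (f : L -> M) :
  frame_hom f -> meet_hom f.
Proof. by case. Qed.

(** * Right adjoints of frame homomorphisms *)

Section RightAdjoint.
Context d (L : frameType d) d' (M : frameType d') (f : L -> M).
Hypothesis fP : frame_hom f.

Definition frame_radj (m : M) : L := frame_sup [set x | f x <= m].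

Lemma frame_radj_galois : galois f frame_radj.
Proof.
move=> x m; apply/idP/idP => [fxm|/(meet_hom_le (frame_hom_meet fP)) xm].
  exact: le_frame_sup.
(* Since [f] preserves the supremum defining [frame_radj m], its value there is still at most
   [m]. *)
apply: le_trans xm _; have [_ _ fS] := fP.
have [_] := fS _ _ (frame_supP [set y | f y <= m]).
by apply=> _ [y fy <-].
Qed.

(** Right adjoints preserve meets. Direct image along [frame_radj] is therefore defined and serves
    as right adjoint to direct image along [f]. *)
Lemma frame_radj_meet : meet_hom frame_radj.
Proof.
split=> [|m n].
  by apply/eqP; rewrite eq_le lex1 -frame_radj_galois lex1.
apply/eqP; rewrite eq_le; apply/andP; split.
  by rewrite lexI -!frame_radj_galois -lexI frame_radj_galois.
by rewrite -frame_radj_galois (frame_hom_meet fP).2 leI2 // frame_radj_galois.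
Qed.

Lemma filter_image_cd_hom : cd_hom (filter_image (frame_hom_meet fP)).
Proof.
split; first exact: filter_image_continuous.
  by exists (filter_preimage (frame_hom_meet fP));
    exact: adjoint_preimage_image.
by exists (filter_image frame_radj_meet);
  exact: adjoint_image frame_radj_galois.
Qed.

End RightAdjoint.

(** * Complete distributivity of filter spaces *)

Section FilterSpaceDistributive.
Context d (L : frameType d).

Definition sharp_open (x : L) : opens (filters L) := Opens (open_sharp x).

Lemma sharp_open_meet : meet_hom sharp_open.
Proof.
split=> [|x y]; apply: opens_ext; apply/seteqP; split=> F //=.
- by move=> _; exact: filter_top.
- by move=> Fxy; split; apply: filter_up Fxy; rewrite ?leIl ?leIr.
- by move=> [Fx Fy]; exact: filter_meet.
Qed.

Definition sharp_ladj (U : opens (filters L)) : L :=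
  frame_sup [set x | sharp x `<=` open_set U].

Lemma sharp_galois : galois sharp_ladj sharp_open.
Proof.
move=> U x; apply/idP/idP => [Ux|/opens_leP /= Ux].
  apply/opens_leP => F /((filters_openP _).1 (open_setP U))[y Fy yU].
  by apply: filter_up Fy; apply: le_trans Ux; exact: le_frame_sup.
apply: frame_sup_le => y yU.
(* The greatest point of [sharp y] lies in [U], hence in [sharp x], which says [y <= x]. *)
by have := Ux _ ((sharp_subP _ (open_setP U)).1 yU); exact.
Qed.

(** The infinite distributive law of [L] enters here, through [frame_supI_le]. It makes inverse
    image along [sharp_ladj] a map of filter spaces. *)
Lemma sharp_ladj_meet : meet_hom sharp_ladj.
Proof.
split=> [|U V]; apply/eqP; rewrite eq_le.
  by rewrite lex1 /=; exact: le_frame_sup.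
rewrite lexI; apply/andP; split.
  by apply/andP; split; apply: frame_sup_le => x xUV; apply: le_frame_sup;
    apply: (subset_trans xUV) => F [].
apply: frame_supI_le => x y xU yV; apply: le_frame_sup => F Fxy.
by split; [apply: xU|apply: yV]; apply: filter_up Fxy; rewrite ?leIl ?leIr.
Qed.

(** The sets [sharp x] with [x] in [F] form a neighbourhood base of [F]. As a direct image, the
    Yoneda map falls under [adjoint_preimage_image]. *)
Lemma yoneda_filters : @yoneda (filters L) = filter_image sharp_open_meet.
Proof.
apply/funext => F; apply: filters_ext => U /=; split.
  move=> /((filters_openP _).1 (open_setP U))[x Fx xU]; exists x => //.
  exact/opens_leP.
by move=> [x Fx /opens_leP]; exact.
Qed.

Lemma filters_completely_distributive : completely_distributive (filters L).
Proof.
exists (filter_preimage sharp_open_meet); split.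
  by rewrite yoneda_filters; exact: adjoint_preimage_image.
by exists (filter_preimage sharp_ladj_meet);
  exact: adjoint_preimage sharp_galois.
Qed.

End FilterSpaceDistributive.

Definition filter_cdspace (L : frame) : cdspace :=
  CDSpace (filters_T0 (L := L)) (filters_completely_distributive L).

Definition filter_fmap (L M : Frm) (f : hom L M) :
    @hom CDTop (filter_cdspace L) (filter_cdspace M) :=
  exist _ _ (filter_image_cd_hom (svalP f)).

Lemma filter_fmap_id (L : Frm) : filter_fmap (idm L) = idm _.
Proof.
apply: concrete_hom_ext; apply/funext => F; apply: filters_ext => x.
by split=> [[y Fy yx]|Fx]; [exact: filter_up yx Fy|exists x].
Qed.

Lemma filter_fmap_comp (L M N : Frm) (g : hom M N) (f : hom L M) :
  filter_fmap (comp g f) = comp (filter_fmap g) (filter_fmap f).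
Proof.
apply: concrete_hom_ext; apply/funext => F; apply: filters_ext => n.
split=> [[x Fx xn]|[m [x Fx xm] mn]].
  by exists (sval f x) => //; exists x.
exists x => //; apply: le_trans mn.
exact: meet_hom_le (frame_hom_meet (svalP g)) _ _ xm.
Qed.

Definition filter_functor : functor Frm CDTop :=
  Functor filter_fmap_id filter_fmap_comp.

(** * From completely distributive spaces to frames *)

Section OpenSup.
Variable X : cdspace.
Implicit Types (x z : X) (U V : opens X).

Definition cd_sup : presheaf_space X -> X := sval (cid (cd_distributive X)).

Lemma cd_sup_adjoint : adjoint cd_sup (@yoneda X).
Proof. exact: (svalP (cid (cd_distributive X))).1. Qed.

(** The left adjoint [t] of [Sup]; by [le_open_supP] it collects the opens whose supremum lies above
    the point. *)
Definition cd_below : X -> presheaf_space X :=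
  sval (cid (svalP (cid (cd_distributive X))).2).

Lemma cd_below_adjoint : adjoint cd_below cd_sup.
Proof. exact: svalP (cid (svalP (cid (cd_distributive X))).2). Qed.

(** One inequality is the counit. The other is the unit at [yoneda x], because the Yoneda map
    reflects the order. *)
Lemma cd_sup_yoneda x : cd_sup (yoneda x) = x.
Proof.
apply: under_le_anti; first exact: cd_T0.
  by case: cd_sup_adjoint => _ _ _; exact.
case: cd_sup_adjoint => _ _ /(_ (yoneda x))/filters_leP yx _.
by apply/under_leP => U oU Ux; exact: (yx (Opens oU)).
Qed.

(** Transposing [x <= Sup (yoneda x)] across [t -| Sup] gives [t x <= yoneda x], to which [Sup] is
    then applied. *)
Lemma cd_sup_below x : under_le (cd_sup (cd_below x)) x.
Proof.
rewrite -[X in under_le _ X]cd_sup_yoneda.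
apply: under_le_mono; first by case: cd_sup_adjoint.
by rewrite (adjoint_le _ _ cd_below_adjoint) cd_sup_yoneda;
  exact: under_le_refl.
Qed.

(** The presheaf attached to an open set is its principal filter, so this is the supremum of [U] in
    [X], as [open_sup_leP] confirms. *)
Definition open_sup U : X := cd_sup (principal_filter U).

Lemma le_open_supP z U : under_le z (open_sup U) <-> filter_set (cd_below z) U.
Proof.
rewrite -(adjoint_le _ _ cd_below_adjoint) filters_leP; split.
  by apply; exact: lexx.
by move=> zU V UV; exact: filter_up UV zU.
Qed.

(** Across [Sup -| yoneda] the left side says that every open neighbourhood of [z] contains [U];
    these neighbourhoods intersect in [down z]. *)
Lemma open_sup_leP U z : under_le (open_sup U) z <-> open_set U `<=` down z.
Proof.
rewrite (adjoint_le _ _ cd_sup_adjoint) filters_leP; split=> [zU u Uu|Uz V Vz].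
  by apply/under_leP => V oV Vz; exact: (opens_leP _ _ (zU (Opens oV) Vz)).
by apply/opens_leP => u /Uz/under_leP; apply=> //; exact: open_setP.
Qed.

Lemma down_open_sup_open U : open (down (open_sup U)).
Proof.
have -> : down (open_sup U) = cd_below @^-1` sharp U.
  by apply/seteqP; split=> z /le_open_supP.
by apply: open_comp (open_sharp U) => z _;
  case: cd_below_adjoint => + _ _ _; apply.
Qed.

(* If [x = Sup (below x)] lies in [U] then so does the supremum of some open
   [V] in the filter [below x], by continuity of [Sup] at [below x]. *)
Lemma principal_nbhd x (U : set X) : open U -> U x ->
  exists V, under_le x (open_sup V) /\ U (open_sup V).
Proof.
move=> oU Ux; have oP : open (cd_sup @^-1` U).
  by apply: open_comp oU => z _; case: cd_sup_adjoint => + _ _ _; apply.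
have [|V xV VU] := (filters_openP _).1 oP (cd_below x).
  by move: (@cd_sup_below x) => /under_leP; apply.
by exists V; split; [exact/le_open_supP|apply: VU; exact: lexx].
Qed.

End OpenSup.

(* In a filter space [filters L] these points are exactly the principal filters,
   ordered as in [L]. *)
Record principal (X : cdspace) := Principal {
  point :> X;
  down_point_open : open (down point)
}.

HB.instance Definition _ (X : cdspace) := gen_eqMixin (principal X).
HB.instance Definition _ (X : cdspace) := gen_choiceMixin (principal X).

(** * The frame of points with open down-set *)

Section PrincipalFrame.
Variable X : cdspace.
Implicit Types (p q r : principal X) (U V : opens X).

Lemma principal_ext p q : point p = point q -> p = q.
Proof.
by case: p q => [x ox] [y oy] /= e; subst y; congr Principal;
  exact: Prop_irrelevance.
Qed.

Definition principal_le p q : bool := `[< under_le (point p) (point q) >].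

Lemma principal_le_refl : reflexive principal_le.
Proof. by move=> p; apply/asboolP; exact: under_le_refl. Qed.

Lemma principal_le_anti : antisymmetric principal_le.
Proof.
move=> p q /andP[/asboolP pq /asboolP qp]; apply: principal_ext.
by apply: under_le_anti => //; exact: cd_T0.
Qed.

Lemma principal_le_trans : transitive principal_le.
Proof.
move=> p q r /asboolP qp /asboolP pr; apply/asboolP; exact: under_le_trans pr.
Qed.

HB.instance Definition _ := Order.Le_isPOrder.Build opens_display (principal X)
  principal_le_refl principal_le_anti principal_le_trans.

Lemma principal_leP p q : reflect (under_le (point p) (point q)) (p <= q).
Proof. exact: asboolP. Qed.

Definition open_down p : opens X := Opens (down_point_open p).

Definition principal_sup U : principal X := Principal (down_open_sup_open U).

Lemma principal_sup_leP U p :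
  reflect (open_set U `<=` down (point p)) (principal_sup U <= p).
Proof. by apply: (iffP (principal_leP _ _)) => /open_sup_leP. Qed.

(** The point [p] is the greatest element of its down-set. Hence every principal point is an
    [open_sup], and [le_open_supP] applies to it. *)
Lemma open_sup_down p : open_sup (open_down p) = p.
Proof.
apply: under_le_anti; [exact: cd_T0|exact/open_sup_leP|].
have /open_sup_leP := @under_le_refl _ (open_sup (open_down p)).
by apply; exact: under_le_refl.
Qed.

Lemma le_principalP (z : X) p :
  under_le z p <-> filter_set (cd_below z) (open_down p).
Proof. by rewrite -[X in under_le z X]open_sup_down; exact: le_open_supP. Qed.

Definition principal_meet p q := principal_sup (open_down p `&` open_down q).
Definition principal_join p q := principal_sup (open_down p `|` open_down q).
Definition principal_bot := principal_sup \bot.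
Definition principal_top := principal_sup \top.

(** The filter [cd_below z] is closed under meets. As [z] is arbitrary, this is a meet in all of
    [X], not only among principal points. *)
Lemma principal_meet_underP (z : X) p q :
  under_le z (principal_meet p q) <-> under_le z p /\ under_le z q.
Proof.
rewrite le_open_supP !le_principalP; split=> [zpq|[]]; last exact: filter_meet.
by split; apply: filter_up zpq; rewrite ?leIl ?leIr.
Qed.

Lemma le_principal_top (z : X) : under_le z principal_top.
Proof. by apply/le_open_supP; exact: filter_top. Qed.

Lemma principal_meetP p q r :
  (p <= principal_meet q r) = (p <= q) && (p <= r).
Proof.
apply/principal_leP/andP => [/principal_meet_underP[pq pr]|].
  by split; exact/principal_leP.
by move=> [/principal_leP pq /principal_leP pr]; exact/principal_meet_underP.
Qed.

Lemma down_subP p q : (down (point p) `<=` down (point q)) <-> p <= q.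
Proof.
split=> [pq|/principal_leP pq z zp]; last exact: under_le_trans pq.
by apply/principal_leP; apply: pq; exact: under_le_refl.
Qed.

Lemma principal_joinP p q r :
  (principal_join p q <= r) = (p <= r) && (q <= r).
Proof.
apply/principal_sup_leP/andP => /=; rewrite subUset.
  by move=> [/down_subP pr /down_subP qr].
by move=> [/down_subP pr /down_subP qr].
Qed.

HB.instance Definition _ := Order.POrder_MeetJoin_isLattice.Build
  opens_display (principal X) principal_meetP principal_joinP.

Lemma principal_le0x p : principal_bot <= p.
Proof. by apply/principal_sup_leP; exact: sub0set. Qed.

Lemma principal_lex1 p : p <= principal_top.
Proof. by apply/principal_leP; exact: le_principal_top. Qed.

HB.instance Definition _ :=
  Order.hasBottom.Build opens_display (principal X) principal_le0x.
HB.instance Definition _ :=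
  Order.hasTop.Build opens_display (principal X) principal_lex1.

Definition downs (A : set (principal X)) : opens X :=
  opens_sup (open_down @` A).

Lemma downs_subP (A : set (principal X)) (z : X) :
  open_set (downs A) `<=` down z <-> forall p, A p -> under_le p z.
Proof.
split=> [Az p Ap|Az x [_ [p Ap <-] xp]]; last exact: under_le_trans (Az p Ap).
by apply: Az; exists (open_down p); [exists p|exact: under_le_refl].
Qed.

Lemma principal_supP (A : set (principal X)) :
  supremums A (principal_sup (downs A)).
Proof.
split=> [p Ap|r Ar].
  by apply/principal_leP; apply: (downs_subP _ _).1 Ap;
    exact/open_sup_leP/under_le_refl.
by apply/principal_sup_leP/downs_subP => p /Ar/principal_leP.
Qed.

(** Suprema of principal points remain suprema in all of [X], also against bounds [z] whose down-set
    is not open. *)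
Lemma principal_sup_underP (A : set (principal X)) s (z : X) :
  supremums A s -> under_le s z <-> forall p, A p -> under_le p z.
Proof.
move=> [ubs lubs]; split=> [sz p /ubs/principal_leP ps|Az].
  exact: under_le_trans sz.
have /lubs/principal_leP sA := (principal_supP A).1.
by apply: under_le_trans sA _; exact/open_sup_leP/downs_subP.
Qed.

Lemma principal_has_sup (A : set (principal X)) : supremums A !=set0.
Proof. by exists (principal_sup (downs A)); exact: principal_supP. Qed.

Lemma principal_meet_sup p (A : set (principal X)) s :
  supremums A s -> supremums [set p `&` a | a in A] (p `&` s).
Proof.
move=> As; split=> [_ [a Aa <-]|r ubr]; first exact: leI2 (As.1 a Aa).
have /principal_leP/le_open_supP sA : s <= principal_sup (downs A).
  by apply: As.2; case: (principal_supP A).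
apply/principal_leP.
have /principal_meet_underP[/le_principalP ps ss] :=
  @under_le_refl _ (point (p `&` s)).
(* The filter [cd_below] at the meet of [p] and [s] contains both [open_down p] and [downs A], hence
   their intersection. Each point of that intersection lies below [p] and below some [a] in [A]. *)
have psA : under_le (p `&` s) (open_sup (open_down p `&` downs A)).
  apply/le_open_supP; apply: filter_meet => //; apply/le_open_supP.
  by apply: under_le_trans ss _; exact/le_open_supP.
apply: under_le_trans psA _; apply/open_sup_leP => z [zp [_ [a Aa <-] za]].
have /ubr/principal_leP par : [set p `&` a | a in A] (p `&` a) by exists a.
by apply: under_le_trans par; exact/principal_meet_underP.
Qed.

HB.instance Definition _ := isFrame.Build opens_display (principal X)
  principal_has_sup principal_meet_sup.

End PrincipalFrame.

Definition principal_frame (X : cdspace) : frame := MkFrame (principal X).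

(** * Action on maps with both adjoints *)

Section PrincipalMap.
Variables (X Y : cdspace) (f : X -> Y).
Hypothesis fP : cd_hom f.

Lemma principal_map_open (p : principal X) : open (down (f p)).
Proof.
have [_ [l lf] _] := fP.
have -> : down (f p) = l @^-1` down p.
  by apply/seteqP; split=> z;
    [move/(adjoint_le _ _ lf)|move=> /(adjoint_le _ _ lf)].
by apply: open_comp (down_point_open p) => z _; case: lf => + _ _ _; apply.
Qed.

Definition principal_map (p : principal X) : principal Y :=
  Principal (principal_map_open p).

(** The left adjoint [l] gives preservation of finite meets, the right adjoint [r] that of
    suprema. *)
Lemma principal_map_frame_hom : frame_hom principal_map.
Proof.
have [_ [l lf] [r fr]] := fP; split=> [|p q|A s As].
- apply: le_anti; rewrite lex1; apply/principal_leP => /=.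
  by apply/(adjoint_le _ _ lf); exact: le_principal_top.
- apply: le_anti; apply/andP; split.
    by rewrite lexI; apply/andP; split; apply/principal_leP;
      apply: under_le_mono;
      (try by case: fP); apply/principal_leP; rewrite ?leIl ?leIr.
  have /principal_meet_underP[] :=
    @under_le_refl _ (point (principal_map p `&` principal_map q)).
  move=> /(adjoint_le _ _ lf) lp /(adjoint_le _ _ lf) lq.
  by apply/principal_leP/(adjoint_le _ _ lf)/principal_meet_underP.
- split=> [_ [p Ap <-]|q fAq].
    apply/principal_leP; apply: under_le_mono; first by case: fP.
    by apply/principal_leP; case: As => + _; apply.
  (* The point [r q] need not be principal, so the supremum property in all of [X] is used. *)
  apply/principal_leP/(adjoint_le _ _ fr)/(principal_sup_underP _ As) => p Ap.
  by apply/(adjoint_le _ _ fr)/(principal_leP (principal_map p));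
  apply: fAq; exists p.
Qed.

End PrincipalMap.

Definition principal_fmap (X Y : CDTop) (f : hom X Y) :
    @hom Frm (principal_frame X) (principal_frame Y) :=
  exist _ _ (principal_map_frame_hom (svalP f)).

Lemma principal_fmap_id (X : CDTop) : principal_fmap (idm X) = idm _.
Proof. by apply: concrete_hom_ext; apply/funext => p; exact: principal_ext. Qed.

Lemma principal_fmap_comp (X Y Z : CDTop) (g : hom Y Z) (f : hom X Y) :
  principal_fmap (comp g f) = comp (principal_fmap g) (principal_fmap f).
Proof. by apply: concrete_hom_ext; apply/funext => p; exact: principal_ext. Qed.

Definition principal_functor : functor CDTop Frm :=
  Functor principal_fmap_id principal_fmap_comp.

(** * The equivalence *)

Section FrameUnit.
Variable L : frame.

Lemma principal_filter_down_open (x : L) : open (down (principal_filter x)).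
Proof. by rewrite -sharp_downE; exact: open_sharp. Qed.

Definition frame_unit (x : L) : principal (filter_cdspace L) :=
  @Principal (filter_cdspace L) _ (principal_filter_down_open x).

Lemma frame_unit_le x y : (frame_unit x <= frame_unit y) = (x <= y).
Proof.
apply/principal_leP/idP => [/filters_leP|xy]; first by apply; exact: lexx.
by apply/filters_leP => z yz; exact: le_trans yz.
Qed.

Lemma frame_unit_surj (p : principal (filter_cdspace L)) :
  exists x, frame_unit x = p.
Proof.
(* The open down-set of [p] contains a basic neighbourhood [sharp x] of [p]; the greatest point of
   [sharp x] is then [p] itself. *)
have [|x px xp] := (filters_openP _).1 (down_point_open p) (point p).
  exact: under_le_refl.
exists x; apply: principal_ext; apply: under_le_anti; first exact: filters_T0.
  by apply: xp; exact: lexx.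
by apply/filters_leP => y xy; exact: filter_up xy px.
Qed.

End FrameUnit.

(** An order isomorphism is both left and right adjoint to its inverse, so it preserves meets and
    suprema. *)
Lemma order_iso_frame_hom d (L : frameType d) d' (M : frameType d')
    (f : L -> M) (g : M -> L) :
  cancel f g -> cancel g f -> {mono f : x y / x <= y} -> frame_hom f.
Proof.
move=> fK gK f_le.
have fg x m : (f x <= m) = (x <= g m) by rewrite -{1}[m]gK f_le.
have gf m x : (m <= f x) = (g m <= x) by rewrite -{1}[m]gK f_le.
split=> [|x y|A s [ubs lubs]].
- by apply: le_anti; rewrite lex1 gf lex1.
- apply: le_anti; rewrite lexI !f_le leIl leIr /= gf lexI -!gf.
  by rewrite leIl leIr.
- split=> [_ [x Ax <-]|m fAm]; first by rewrite f_le; exact: ubs.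
  by rewrite fg; apply: lubs => x Ax; rewrite -fg; apply: fAm; exists x.
Qed.

Lemma order_iso_is_iso (L M : frame) (f : L -> M) (fP : frame_hom f)
    (g : M -> L) :
  cancel f g -> cancel g f -> {mono f : x y / x <= y} ->
  @is_iso Frm L M (exist _ f fP).
Proof.
move=> fK gK f_le.
have g_le : {mono g : x y / x <= y} by move=> x y; rewrite -f_le !gK.
exists (exist _ g (order_iso_frame_hom gK fK g_le)).
by split; apply: concrete_hom_ext; apply/funext.
Qed.

Lemma frame_unit_natural :
  naturally_isomorphic (functor_id Frm)
    (functor_comp principal_functor filter_functor).
Proof.
have unitK (L : Frm) : {g : principal (filter_cdspace L) -> L |
    cancel (@frame_unit L) g & cancel g (@frame_unit L)}.
  (* Choice gives a right inverse of the surjection; it is also a left inverse because [frame_unit]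
     reflects the order. *)
  have [g gK] := choice (@frame_unit_surj L); exists g => // x.
  by apply: le_anti; rewrite -!(@frame_unit_le L) !gK lexx.
have unit_hom (L : Frm) : frame_hom (@frame_unit L).
  have [g gK Kg] := unitK L.
  exact: order_iso_frame_hom gK Kg (@frame_unit_le L).
exists (fun L => exist _ _ (unit_hom L)); split=> [L M f|L].
  apply: concrete_hom_ext; apply/funext => x; apply: principal_ext.
  exact: filter_image_principal.
have [g gK Kg] := unitK L.
exact: (@order_iso_is_iso L (principal_frame (filter_cdspace L)) _ (unit_hom L)
  g gK Kg (@frame_unit_le L)).
Qed.

(** * The homeomorphism with the filter space of the principal points *)

Section SpaceUnit.
Variable X : cdspace.

Let above (x : X) : set (principal X) := [set p | under_le x p].

Lemma above_top x : above x \top.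
Proof. exact: le_principal_top. Qed.

Lemma above_up x (p q : principal X) : p <= q -> above x p -> above x q.
Proof. by move=> /principal_leP pq xp; exact: under_le_trans pq. Qed.

Lemma above_meet x (p q : principal X) :
  above x p -> above x q -> above x (p `&` q).
Proof. by move=> xp xq; exact/principal_meet_underP. Qed.

Definition space_unit (x : X) : filters (principal X) :=
  Filters (above_top x) (@above_up x) (@above_meet x).

Lemma open_down_meet : meet_hom (@open_down X).
Proof.
split=> [|p q]; apply: opens_ext; apply/seteqP; split=> z //=.
- by move=> _; exact: le_principal_top.
- by move=> /principal_meet_underP.
- by move=> zpq; exact/principal_meet_underP.
Qed.

Definition space_counit (F : filters (principal X)) : X :=
  cd_sup (filter_image open_down_meet F).

Lemma space_unit_continuous : continuous space_unit.
Proof. by apply: filters_continuous => p; exact: down_point_open. Qed.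

Lemma space_counit_continuous : continuous space_counit.
Proof.
move=> F; apply: continuous_comp; first exact: filter_image_continuous.
by case: (cd_sup_adjoint X) => + _ _ _; apply.
Qed.

(** By [principal_nbhd] the open principal down-sets containing [x] generate its neighbourhood
    filter, whose [cd_sup] is [x]. *)
Lemma space_unitK : cancel space_unit space_counit.
Proof.
move=> x; rewrite -[RHS]cd_sup_yoneda; congr cd_sup.
apply: filters_ext => U; split=> [[p xp /opens_leP pU]|Ux]; first exact: pU.
have [V [xV UV]] := principal_nbhd (open_setP U) Ux.
exists (principal_sup V) => //; apply/opens_leP.
exact: down_sub_open (open_setP U) UV.
Qed.

(** Across [Sup -| yoneda], the counit lies below [p] exactly when every open neighbourhood of [p]
    contains [down q] for some [q] in [F]. The smallest such neighbourhood is [down p]. *)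
Lemma space_counitK : cancel space_counit space_unit.
Proof.
move=> F; apply: filters_ext => p /=.
rewrite /above /= (adjoint_le _ _ (cd_sup_adjoint X)) filters_leP.
split=> [/(_ (open_down p) (@under_le_refl _ _))[q Fq]|Fp U Up].
  move=> /opens_leP/down_subP qp; exact: filter_up qp Fq.
by exists p => //; apply/opens_leP; exact: down_sub_open (open_setP U) Up.
Qed.

Lemma space_unit_cd_hom : cd_hom space_unit.
Proof.
split; [exact: space_unit_continuous| |]; exists space_counit;
  apply: adjoint_can; by [exact: space_unit_continuous
    |exact: space_counit_continuous|exact: space_unitK|exact: space_counitK].
Qed.

Lemma space_counit_cd_hom : cd_hom space_counit.
Proof.
split; [exact: space_counit_continuous| |]; exists space_unit;
  apply: adjoint_can; by [exact: space_unit_continuous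
    |exact: space_counit_continuous|exact: space_unitK|exact: space_counitK].
Qed.

End SpaceUnit.

Lemma space_unit_map (X Y : cdspace) (f : X -> Y) (fP : cd_hom f) (x : X) :
  space_unit (f x) =
  filter_image (frame_hom_meet (principal_map_frame_hom fP)) (space_unit x).
Proof.
have [cf _ _] := fP; apply: filters_ext => q.
split=> [fxq|[p xp /principal_leP pq]].
  have oq : open (f @^-1` down q).
    by apply: open_comp (down_point_open q) => z _; exact: cf.
  (* The preimage of [down q] is an open neighbourhood of [x], so it contains a principal point
     above [x], the required witness. *)
  have [V [xV fVq]] := principal_nbhd oq fxq.
  by exists (principal_sup V) => //; exact/principal_leP.
by apply: under_le_trans pq; exact: under_le_mono.
Qed.

Lemma space_counit_natural :
  naturally_isomorphic (functor_comp filter_functor principal_functor)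
    (functor_id CDTop).
Proof.
exists (fun X : CDTop => exist _ _ (space_counit_cd_hom X)); split=> [X Y f|X].
  apply: concrete_hom_ext; apply/funext => F /=.
  (* Applying the injective [space_unit] reduces naturality of the counit to that of the unit. *)
  apply: (can_inj (@space_unitK Y)); rewrite (space_unit_map (svalP f)).
  by rewrite space_counitK [RHS]space_counitK; exact: filters_ext.
exists (exist _ _ (space_unit_cd_hom X)); split; apply: concrete_hom_ext;
  apply/funext; [exact: space_counitK|exact: space_unitK].
Qed.

Theorem theorem7p16 : equivalent_categories Frm CDTop.
Proof.
by exists filter_functor, principal_functor; split;
  [exact: frame_unit_natural|exact: space_counit_natural].
Qed.
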